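(* For arbitrary positive integers $r,n$, there is a bijection between $C_{r,n}$ and $\Omega_{r,n}$.
   Context: **Segments.** A segment is a sequence $s=(a,a,\dots,a)\in(\mathbb C^* )^k$ with $k\ge1$; its length is $|s|=k$. Let $$C_{r,n}=\Bigl\{\mathbf s=\{s_1,\dots,s_p\}\ \Big|\ p\ge1,\ \sum_{1\le i\le p}|s_i|=r,\ |s_i|\le n\text{ for all }i\Bigr\},$$ where $\{s_1,\dots,s_p\}$ denotes an unordered collection (multiset) of segments. (This set parametrizes the finite-dimensional simple modules of the affine Schur algebra $\widehat S(n,r)_{\mathbb C}$.) **The set $\Omega_{r,n}$.** $\Lambda^+(n,r)=\{(\lambda_1,\dots,\lambda_n)\mid\lambda_i\in\mathbb Z,\ \lambda_1\ge\dots\ge\lambda_n\ge0,\ \sum_i\lambda_i=r\}$. For $\lambda\in\Lambda^+(n,r)$ put $\lambda_{n+1}=0$ and $m(i)=\lambda_1-\lambda_{i+1}$ for $1\le i\le n$, and $$\Omega_\lambda=\{\underline a=(a_1,\dots,a_{\lambda_1})\in\mathbb C^{\lambda_1}\mid a_{m(i)}\ne0\text{ for all }1\le i\le n\text{ with }m(i)\ge1\}.$$ Let $\Omega_{r,n}=\bigsqcup_{\lambda\in\Lambda^+(n,r)}\Omega_\lambda$ (disjoint union). *)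

(* Defs.v *)
From mathcomp Require Import all_boot all_order all_algebra.
From mathcomp Require Import finmap multiset complex reals.

Set Implicit Arguments.
Unset Strict Implicit.
Unset Printing Implicit Defensive.

Local Open Scope ring_scope.
Local Open Scope mset_scope.

Definition is_segment (R : realType) (s : seq R[i]) : bool :=
  [&& (0 < size s)%N, constant s & all (fun a => a != 0) s].

Definition segment (R : realType) : Type := {s : seq R[i] | is_segment s}.

Definition seg_length (R : realType) (s : segment R) : nat := size (val s).

(* A multiset coerces to the sequence of its elements, repeated according to
   multiplicity, so size, sum and all below count multiplicities. *)
Definition in_C (R : realType) (r n : nat) (S : {mset segment R}) : bool :=
  [&& (0 < size S)%N,
      (\sum_(s <- S) seg_length s)%N == r
    & all (fun s => seg_length s <= n)%N S].

Definition C (R : realType) (r n : nat) : Type :=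
  {S : {mset segment R} | in_C r n S}.

Definition Lambda_plus (n r : nat) : Type :=
  {l : n.-tuple nat | sorted geq l && (sumn l == r)}.

(* For 1 <= i <= n, the entry lambda_i; it is 0 for i = n + 1. *)
Definition part (n r : nat) (l : Lambda_plus n r) (i : nat) : nat :=
  nth 0%N (val l) i.-1.

Definition m (n r : nat) (l : Lambda_plus n r) (i : nat) : nat :=
  (part l 1 - part l i.+1)%N.

(* The tuple a is indexed from 0, so that a_j is the entry of rank j - 1; the
   index i of the definition ranges over 1, ..., n. *)
Definition in_Omega (R : realType) (n r : nat) (l : Lambda_plus n r)
    (a : (part l 1).-tuple R[i]) : bool :=
  [forall i : 'I_n, (1 <= m l i.+1)%N ==> (nth 0 a (m l i.+1).-1 != 0)].

Definition Omega_at (R : realType) (n r : nat) (l : Lambda_plus n r) : Type :=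
  {a : (part l 1).-tuple R[i] | in_Omega a}.

Definition Omega (R : realType) (r n : nat) : Type :=
  {l : Lambda_plus n r & Omega_at R l}.

(* Main.v *)
(* A multiset of nonzero complex numbers z_1, ..., z_k is the same thing as the
   monic polynomial (X - z_1) ... (X - z_k), that is, as k complex numbers (its
   lower coefficients) whose last one, the constant coefficient, is nonzero.
   Given a multiset of segments with k_i segments of length i, encode in this
   way the entries of the segments of each length i = 1, ..., n, and concatenate
   these blocks of sizes k_1, ..., k_n.  With lambda_j = k_j + ... + k_n one has
   m(i) = k_1 + ... + k_i, so the condition a_{m(i)} <> 0 says that the last
   entry of each nonempty block is nonzero: the result lies in Omega_lambda. *)
Require Import Defs.
From mathcomp Require Import all_boot reals.
From mathcomp Require Import all_order all_algebra finmap multiset complex.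

Set Implicit Arguments.
Unset Strict Implicit.
Unset Printing Implicit Defensive.

Import GRing.Theory.

(** The inverse picks preimages with [xchoose], so both halves of the bijection need only
    injectivity and surjectivity. *)
Lemma inj_surj_bij (T : choiceType) (U : eqType) (f : T -> U) :
  injective f -> (forall y, exists x, f x = y) -> bijective f.
Proof.
move=> f_inj f_surj.
have ex_pre y : exists x, f x == y by have [x <-] := f_surj y; exists x.
have preK : cancel (fun y => xchoose (ex_pre y)) f.
  by move=> y; apply/eqP/(xchooseP (ex_pre y)).
by exists (fun y => xchoose (ex_pre y)) => // x; apply: f_inj; rewrite preK.
Qed.

(** * Multiplicities of part sizes and the conjugate partition *)

Fixpoint suffix_sums (k : seq nat) : seq nat :=
  if k is x :: k' then sumn k :: suffix_sums k' else [::].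

(** The default 0 of [head] is the convention that lambda_{n+1} = 0. *)
Fixpoint consecutive_diffs (l : seq nat) : seq nat :=
  if l is x :: l' then x - head 0 l' :: consecutive_diffs l' else [::].

Lemma size_suffix_sums k : size (suffix_sums k) = size k.
Proof. by elim: k => //= x k ->. Qed.

Lemma head_suffix_sums k : head 0 (suffix_sums k) = sumn k.
Proof. by case: k. Qed.

Lemma nth_suffix_sums k j : nth 0 (suffix_sums k) j = sumn (drop j k).
Proof. by elim: k j => [|x k IHk] [|j] //=; rewrite IHk. Qed.

Lemma suffix_sumsK : cancel suffix_sums consecutive_diffs.
Proof. by elim=> //= x k ->; rewrite head_suffix_sums addnK. Qed.

(** The differences telescope; sortedness keeps the truncated subtraction exact. *)
Lemma consecutive_diffsK l :
  sorted geq l -> suffix_sums (consecutive_diffs l) = l.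
Proof.
elim: l => //= x l IHl l_sorted.
have {}IHl := IHl (path_sorted l_sorted).
rewrite IHl -(head_suffix_sums (consecutive_diffs l)) IHl.
rewrite subnK //; case: l l_sorted {IHl} => //= y l; by case/andP.
Qed.

Lemma sumn_consecutive_diffs l :
  sorted geq l -> sumn (consecutive_diffs l) = head 0 l.
Proof. by move=> /consecutive_diffsK {2}<-; rewrite head_suffix_sums. Qed.

Lemma suffix_sums_sorted k : sorted geq (suffix_sums k).
Proof.
elim: k => //= x k IHk; case: k IHk => //= y k IHk.
by rewrite leq_addl.
Qed.

(** The multiplicity k_i enters exactly the i sums lambda_1, ..., lambda_i. *)
Lemma sumn_suffix_sums k :
  sumn (suffix_sums k) = \sum_(i < size k) i.+1 * nth 0 k i.
Proof.
elim: k => [|x k IHk] /=; first by rewrite big_ord0.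
rewrite big_ord_recl /= IHk mul1n -addnA; congr (_ + _).
have -> : sumn k = \sum_(i < size k) nth 0 k i.
  by rewrite sumnE (big_nth 0) big_mkord.
by rewrite -big_split /=; apply: eq_bigr.
Qed.

(** * Last entries of concatenated blocks *)

Lemma flatten_take (T : Type) (ss : seq (seq T)) i :
  flatten (take i ss) = take (sumn (take i (shape ss))) (flatten ss).
Proof.
elim: ss i => [|s ss IHss] [|i] //=; rewrite ?take0 //.
by rewrite IHss take_cat ltnNge leq_addr /= addKn.
Qed.

(** A prefix ends with the last entry of its last nonempty block. Appending an empty block repeats
    the previous prefix condition, and its own condition holds by the default 1. *)
Lemma nonzero_last_flattenP (F : fieldType) (bs : seq (seq F)) :
  reflect (forall i, i < size bs -> last 1%R (flatten (take i.+1 bs)) != 0%R)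
          (all (fun b => last 1%R b != 0%R) bs).
Proof.
have step (x : F) b : (x != 0 -> last x b != 0 = (last 1 b != 0))%R.
  by case: b => //= ->; rewrite oner_neq0.
elim/last_ind: bs => [|bs b IHbs]; first by left.
have last_rcons_flatten :
    last 1%R (flatten (rcons bs b)) = last (last 1%R (flatten bs)) b.
  by rewrite -cats1 flatten_cat last_cat /= cats0.
have flatten_neq0 :
    (forall i, i < size bs -> last 1%R (flatten (take i.+1 bs)) != 0%R) ->
    last 1%R (flatten bs) != 0%R.
  case: (bs) => [_|c cs H]; first by rewrite oner_neq0.
  by have := H (size cs) (ltnSn _); rewrite take_oversize.
have take_rcons i : i < size bs -> take i.+1 (rcons bs b) = take i.+1 bs.
  by move=> lt_i; rewrite -cats1 takel_cat.
rewrite all_rcons size_rcons; apply: (iffP andP).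
  case=> b_neq0 /IHbs bs_neq0 i; rewrite ltnS leq_eqVlt => /predU1P[->|lt_i].
    rewrite -(size_rcons bs b) take_size last_rcons_flatten.
    by rewrite step ?flatten_neq0.
  by rewrite take_rcons ?bs_neq0.
move=> H.
have bs_neq0 i : i < size bs -> last 1%R (flatten (take i.+1 bs)) != 0%R.
  by move=> lt_i; rewrite -take_rcons // H // ltnW.
split; last exact/IHbs.
rewrite -(step _ _ (flatten_neq0 bs_neq0)) -last_rcons_flatten.
by have := H (size bs) (ltnSn _); rewrite take_oversize ?size_rcons.
Qed.

(** * Lists of blocks and the set [Omega] *)

Section Blocks.
Variable (R : realType).

Definition is_blocks r n (bs : seq (seq R[i])) : bool :=
  [&& size bs == n, sumn (suffix_sums (shape bs)) == r
    & all (fun b => last 1%R b != 0%R) bs].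

Definition blocks r n : Type := {bs : seq (seq R[i]) | is_blocks r n bs}.

Lemma Omega_eq r n (o o' : Omega R r n) :
  val (tag o) = val (tag o') :> seq nat ->
  val (val (tagged o)) = val (val (tagged o')) :> seq R[i] -> o = o'.
Proof.
case: o o' => [l a] [l' a'] /= /val_inj/val_inj eq_l.
by case: _ / eq_l a' => a' /val_inj/val_inj->.
Qed.

Lemma m_suffix_sums r n (l : Lambda_plus n r) k i :
  val l = suffix_sums k :> seq nat -> m l i.+1 = sumn (take i.+1 k).
Proof.
move=> lE; rewrite /m /part /= lE !nth_suffix_sums drop0.
by rewrite -{1}(cat_take_drop i.+1 k) sumn_cat addnK.
Qed.

(* Both default values make an empty prefix harmless: when m(i) = 0 the
   condition on a_{m(i)} is void, and last 1 [::] = 1 is nonzero. *)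
Lemma in_OmegaE r n (l : Lambda_plus n r) (a : (part l 1).-tuple R[i]) bs :
  val l = suffix_sums (shape bs) :> seq nat -> val a = flatten bs ->
  in_Omega a = all (fun b => last 1%R b != 0%R) bs.
Proof.
move=> lE aE.
have size_bs : size bs = n.
  by have := size_tuple (val l); rewrite lE size_suffix_sums size_map.
have condE i : ((1 <= m l i.+1) ==> (nth 0%R a (m l i.+1).-1 != 0%R)) =
    (last 1%R (flatten (take i.+1 bs)) != 0%R).
  rewrite (m_suffix_sums _ lE) flatten_take aE.
  set k := sumn _.
  have le_k : k <= size (flatten bs).
    by rewrite size_flatten -(cat_take_drop i.+1 (shape bs)) sumn_cat leq_addr.
  case: k le_k => [|k] lt_k /=; first by rewrite take0 /= oner_neq0.
  by rewrite -[in RHS]nth_last size_takel // nth_take //= (set_nth_default 1%R).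
apply/forallP/nonzero_last_flattenP => H i.
  by rewrite size_bs => lt_i; rewrite -condE; apply: (H (Ordinal lt_i)).
by rewrite condE H // size_bs.
Qed.

Section OmegaOfBlocks.
Variables (r n : nat) (bs : blocks r n).

Lemma partition_of_blocks_subproof : size (suffix_sums (shape (val bs))) == n.
Proof. by rewrite size_suffix_sums size_map; case/and3P: (valP bs). Qed.

Lemma Lambda_plus_of_blocks_subproof (l := Tuple partition_of_blocks_subproof) :
  sorted geq l && (sumn l == r).
Proof. by rewrite suffix_sums_sorted /=; case/and3P: (valP bs). Qed.

Definition Lambda_plus_of_blocks : Lambda_plus n r :=
  Sub (Tuple partition_of_blocks_subproof) Lambda_plus_of_blocks_subproof.

Lemma entries_of_blocks_subproof :
  size (flatten (val bs)) == part Lambda_plus_of_blocks 1.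
Proof. by rewrite size_flatten /part /= nth_suffix_sums drop0. Qed.

Lemma Omega_of_blocks_subproof : in_Omega (Tuple entries_of_blocks_subproof).
Proof. by rewrite (@in_OmegaE _ _ _ _ (val bs)) //; case/and3P: (valP bs). Qed.

Definition Omega_of_blocks : Omega R r n :=
  existT (@Omega_at R n r) Lambda_plus_of_blocks
    (Sub (Tuple entries_of_blocks_subproof) Omega_of_blocks_subproof).

End OmegaOfBlocks.

Lemma Omega_of_blocks_bij r n : bijective (@Omega_of_blocks r n).
Proof.
apply: inj_surj_bij => [bs bs' eq_o | [l [a a_in]]].
  (* A list of blocks is determined by its concatenation and its shape, and the partition determines
     the shape. *)
  apply: val_inj; rewrite /= -[val bs]flattenK -[val bs']flattenK.
  have eq_l : suffix_sums (shape (val bs)) = suffix_sums (shape (val bs')).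
    exact: (congr1 (fun o : Omega R r n => val (val (tag o))) eq_o).
  have eq_a : flatten (val bs) = flatten (val bs').
    exact: (congr1 (fun o : Omega R r n => val (val (tagged o))) eq_o).
  by rewrite eq_a (can_inj suffix_sumsK eq_l).
have /andP[l_sorted /eqP l_sum] := valP l.
(* The differences are the block sizes; they add up to lambda_1, the length of [a], so cutting [a]
   loses nothing. *)
pose k := consecutive_diffs (val l); pose bs := reshape k a.
have size_a : size a = sumn k.
  by rewrite size_tuple sumn_consecutive_diffs // /part nth0.
have lE : val l = suffix_sums (shape bs) :> seq nat.
  by rewrite reshapeKl ?size_a // consecutive_diffsK.
have aE : val a = flatten bs by rewrite reshapeKr ?size_a.
have bs_blocks : is_blocks r n bs.
  rewrite /is_blocks -(in_OmegaE lE aE) a_in -lE l_sum eqxx !andbT.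
  by rewrite -(size_map size) -size_suffix_sums -/(shape bs) -lE size_tuple.
by exists (Sub bs bs_blocks); apply: Omega_eq.
Qed.

End Blocks.

(** * Multisets of roots as coefficients of monic polynomials *)

Section LowerCoefficients.
Variable (F : closedFieldType).
Local Open Scope ring_scope.

(* The coefficients of a monic polynomial without the leading one, listed by
   decreasing degree, so that the constant coefficient comes last. *)
Definition lower_coefs (p : {poly F}) : seq F := behead (rev p).

Lemma monic_rev (p : {poly F}) : p \is monic -> rev p = 1 :: lower_coefs p.
Proof.
move=> p_monic; rewrite /lower_coefs.
have : last 1 p = 1.
  rewrite -nth_last -(monicP p_monic) /lead_coef; apply: set_nth_default.
  by rewrite prednK // size_poly_gt0 monic_neq0.
have : p != [::] :> seq F by rewrite -size_eq0 size_poly_eq0 monic_neq0.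
by case/lastP: (p : seq F) => // s x _; rewrite last_rcons rev_rcons => ->.
Qed.

Lemma size_lower_coefs (p : {poly F}) : size (lower_coefs p) = (size p).-1.
Proof. by rewrite size_behead size_rev. Qed.

Lemma lower_coefs_inj (p q : {poly F}) : p \is monic -> q \is monic ->
  lower_coefs p = lower_coefs q -> p = q.
Proof.
move=> /monic_rev p_rev /monic_rev q_rev eq_pq; apply/val_inj/(can_inj revK).
by rewrite p_rev q_rev eq_pq.
Qed.

(** The default 1 is the correct value for p = 1, which has no lower coefficients. *)
Lemma last_lower_coefs (p : {poly F}) : p \is monic ->
  last 1 (lower_coefs p) = p.[0].
Proof.
move=> /monic_rev p_rev; rewrite horner_coef0 -[polyseq p]revK p_rev.
rewrite rev_cons; case/lastP: (lower_coefs p) => // s x.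
by rewrite last_rcons rev_rcons.
Qed.

Definition root_coefs (s : seq F) : seq F :=
  lower_coefs (\prod_(z <- s) ('X - z%:P)).

Lemma size_root_coefs s : size (root_coefs s) = size s.
Proof. by rewrite size_lower_coefs size_prod_XsubC. Qed.

Lemma last_root_coefs s : (last 1 (root_coefs s) != 0) = (0 \notin s).
Proof. by rewrite last_lower_coefs ?monic_prod_XsubC // -root_prod_XsubC. Qed.

(** Unique factorization: the product of the linear factors determines its roots up to order. *)
Lemma eq_root_coefs s t : root_coefs s = root_coefs t <-> perm_eq s t.
Proof.
split=> [/lower_coefs_inj eq_st | st].
  by apply/prod_XsubC_eq/eq_st; apply: monic_prod_XsubC.
by congr lower_coefs; apply: perm_big.
Qed.

(** Algebraic closedness: the monic polynomial with lower coefficients [b] splits into linear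
    factors. *)
Lemma root_coefs_surj b : exists s, root_coefs s = b.
Proof.
pose p := Poly (rev (1 :: b)).
have pE : p = rev (1 :: b) :> seq F.
  by rewrite (@PolyK _ 1) // rev_cons last_rcons oner_neq0.
have p_monic : p \is monic.
  by rewrite monicE lead_coefE nth_last pE rev_cons last_rcons.
have [s p_split] := closed_field_poly_normal p; exists s.
rewrite /root_coefs -[\prod_(_ <- _) _]scale1r -(monicP p_monic) -p_split.
by rewrite /lower_coefs pE revK.
Qed.

End LowerCoefficients.

(** * Multisets of segments and lists of blocks *)

Section SegmentBlocks.
Variable (R : realType).
Local Open Scope mset_scope.

(** A segment amounts to its length and its repeated value, so these lists, for all [i], determine
    [S] up to order. *)
Definition roots_of_length (i : nat) (S : seq (segment R)) : seq R[i] :=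
  [seq head 0%R (val s) | s <- S & seg_length s == i].

Lemma segment_gt0 (s : segment R) : 0 < seg_length s.
Proof. by case/and3P: (valP s). Qed.

Lemma segmentE (s : segment R) : val s = nseq (seg_length s) (head 0%R (val s)).
Proof.
case/and3P: (valP s) => _ /(constantP 0%R)[x]; rewrite /seg_length => + _.
by case: (val s) => //= y t [-> ->]; rewrite size_nseq.
Qed.

Lemma head_segment_neq0 (s : segment R) : head 0%R (val s) != 0%R.
Proof. by case/and3P: (valP s); case: (val s) => //= x t _ _ /andP[]. Qed.

Lemma eq_segment (s t : segment R) :
  (s == t) =
    (seg_length s == seg_length t) && (head 0%R (val s) == head 0%R (val t)).
Proof.
apply/eqP/andP => [-> //|[/eqP eq_len /eqP eq_head]].
by apply: val_inj; rewrite segmentE eq_len eq_head -segmentE.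
Qed.

Lemma count_mem_segment (s : segment R) S :
  count_mem s S =
    count_mem (head 0%R (val s)) (roots_of_length (seg_length s) S).
Proof.
rewrite count_map count_filter; apply: eq_count => t /=.
by rewrite eq_segment andbC.
Qed.

Lemma zero_notin_roots_of_length i S : 0%R \notin roots_of_length i S.
Proof. by apply/mapP => -[s _ /esym/eqP]; apply/negP/head_segment_neq0. Qed.

Lemma sum_seg_length n (S : seq (segment R)) :
  all (fun s => seg_length s <= n) S ->
  \sum_(s <- S) seg_length s =
    \sum_(i < n) i.+1 * size (roots_of_length i.+1 S).
Proof.
(* Each length lies between 1 and [n], so exactly one term of the inner sum survives; the two sums
   are then exchanged. *)
move=> /allP S_le; transitivity
    (\sum_(s <- S) \sum_(i < n) i.+1 * (seg_length s == i.+1)).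
  apply: eq_big_seq => s /S_le.
  case: (seg_length s) (segment_gt0 s) => //= k _ lt_k.
  rewrite (bigD1 (Ordinal lt_k)) //= eqxx muln1 big1 ?addn0 // => i.
  by rewrite -val_eqE /= eqSS eq_sym => /negPf->; rewrite muln0.
rewrite exchange_big /=; apply: eq_bigr => i _.
by rewrite -big_distrr /= size_map size_filter -sumn_count sumnE big_map.
Qed.

Definition blocks_of_mset n (S : {mset segment R}) : seq (seq R[i]) :=
  mkseq (fun i => root_coefs (roots_of_length i.+1 S)) n.

(** Segments have nonzero entries, so 0 is never a root and only the sum condition remains. As an
    equality it serves both the map and its surjectivity. *)
Lemma is_blocks_of_mset r n (S : {mset segment R}) :
  all (fun s => seg_length s <= n) S ->
  is_blocks r n (blocks_of_mset n S) = (\sum_(s <- S) seg_length s == r).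
Proof.
move=> S_le; rewrite /is_blocks size_mkseq eqxx /= andbC.
have -> /= : all (fun b => last 1%R b != 0%R) (blocks_of_mset n S).
  apply/allP => _ /mapP[i _ ->].
  by rewrite last_root_coefs zero_notin_roots_of_length.
rewrite sumn_suffix_sums (sum_seg_length S_le) size_map size_mkseq.
congr (_ == _); apply: eq_bigr => i _.
by rewrite (nth_map [::]) ?size_mkseq // nth_mkseq // size_root_coefs.
Qed.

Lemma blocks_of_C_subproof r n (S : C R r n) :
  is_blocks r n (blocks_of_mset n (val S)).
Proof. by case/and3P: (valP S) => _ S_sum S_le; rewrite is_blocks_of_mset. Qed.

Definition blocks_of_C r n (S : C R r n) : blocks R r n :=
  Sub (blocks_of_mset n (val S)) (blocks_of_C_subproof S).

Lemma blocks_of_mset_inj n (S T : {mset segment R}) :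
  all (fun s => seg_length s <= n) S -> all (fun s => seg_length s <= n) T ->
  blocks_of_mset n S = blocks_of_mset n T -> S = T.
Proof.
move=> S_le T_le eq_ST; apply/msetP => s; rewrite -!count_mem_mset.
(* The blocks do not see segments longer than [n], but these occur in neither multiset. *)
have [le_s|gt_s] := leqP (seg_length s) n; last first.
  have notin (U : {mset segment R}) :
      all (fun s => seg_length s <= n) U -> count_mem s U = 0.
    by move=> /allP U_le; apply/count_memPn/negP => /U_le; rewrite leqNgt gt_s.
  by rewrite !notin.
rewrite !count_mem_segment; apply/permP/eq_root_coefs.
have lt_s : (seg_length s).-1 < n by rewrite prednK ?segment_gt0.
have := congr1 (fun bs => nth [::] bs (seg_length s).-1) eq_ST.
by rewrite !nth_mkseq // prednK ?segment_gt0.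
Qed.

Lemma segment1_subproof : is_segment [:: 1%R : R[i]].
Proof. by rewrite /is_segment /= oner_neq0. Qed.

(* Equals the one-term segment (1) when z = 0. *)
Definition const_segment (i : nat) (z : R[i]) : segment R :=
  insubd (Sub [:: 1%R] segment1_subproof : segment R) (nseq i.+1 z).

Lemma val_const_segment i z : z != 0%R -> val (const_segment i z) = nseq i.+1 z.
Proof.
move=> z_neq0; rewrite val_insubd /is_segment constant_nseq all_nseq z_neq0.
by rewrite size_nseq orbT.
Qed.

Lemma head_const_segment i z :
  z != 0%R -> head 0%R (val (const_segment i z)) = z.
Proof. by move=> /val_const_segment->. Qed.

Lemma length_const_segment i z :
  z != 0%R -> seg_length (const_segment i z) = i.+1.
Proof. by rewrite /seg_length => /val_const_segment->; rewrite size_nseq. Qed.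

Definition mset_of_roots n (rts : nat -> seq R[i]) : {mset segment R} :=
  seq_mset [seq const_segment i z | i <- iota 0 n, z <- rts i].

Lemma mset_of_roots_length n (rts : nat -> seq R[i]) :
  (forall i, i < n -> 0%R \notin rts i) ->
  all (fun s => seg_length s <= n) (mset_of_roots n rts).
Proof.
move=> rts_neq0; rewrite (perm_all _ (perm_eq_seq_mset _)).
apply/allP => s /allpairsPdep[i [z]] [+ z_in ->]; rewrite mem_iota => /= lt_i.
rewrite length_const_segment //.
by apply: contraNneq (rts_neq0 i lt_i) => <-.
Qed.

(** Only the family of index [i] yields length [i.+1]; nonzero roots keep [const_segment] away from
    its fallback value. *)
Lemma roots_of_length_mset_of_roots n (rts : nat -> seq R[i]) i :
  (forall j, j < n -> 0%R \notin rts j) -> i < n ->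
  perm_eq (roots_of_length i.+1 (mset_of_roots n rts)) (rts i).
Proof.
move=> rts_neq0 lt_i; apply/permP => q.
rewrite count_map count_filter (permP (perm_eq_seq_mset _)).
rewrite count_flatten -map_comp sumnE big_map -[in iota 0 n](subn0 n) big_mkord.
rewrite (bigD1 (Ordinal lt_i)) //= big1 ?addn0 => [|j neq_ji].
  rewrite count_map; apply: eq_in_count => z z_in /=.
  have z_neq0 : z != 0%R by apply: contraNneq (rts_neq0 i lt_i) => <-.
  have /= -> := head_const_segment i z_neq0.
  by rewrite length_const_segment // eqxx andbT.
rewrite count_map; apply/eqP; rewrite -leqn0 leqNgt -has_count.
apply/hasPn => z z_in /=.
have z_neq0 : z != 0%R by apply: contraNneq (rts_neq0 j (ltn_ord j)) => <-.
by rewrite length_const_segment // eqSS negb_and orbC neq_ji.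
Qed.

Lemma blocks_of_C_bij r n : 0 < r -> bijective (@blocks_of_C r n).
Proof.
move=> r_gt0; apply: inj_surj_bij => [S T eq_ST | [bs bs_blocks]].
  apply/val_inj/(@blocks_of_mset_inj n); last exact: (congr1 val eq_ST).
  - by case/and3P: (valP S).
  - by case/and3P: (valP T).
have rootsP (b : seq R[i]) : exists s, root_coefs s == b.
  by have [s <-] := root_coefs_surj b; exists s.
pose rts i := xchoose (rootsP (nth [::] bs i)).
have rtsK i : root_coefs (rts i) = nth [::] bs i.
  exact/eqP/(xchooseP (rootsP _)).
have [/eqP size_bs _ /all_nthP bs_neq0] := and3P bs_blocks.
have rts_neq0 i : i < n -> 0%R \notin rts i.
  by move=> lt_i; rewrite -last_root_coefs rtsK bs_neq0 // size_bs.
pose S := mset_of_roots n rts.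
have S_le : all (fun s => seg_length s <= n) S by apply: mset_of_roots_length.
have SE : blocks_of_mset n S = bs.
  apply: (@eq_from_nth _ [::]) => [|i]; rewrite size_mkseq ?size_bs // => lt_i.
  rewrite nth_mkseq // -rtsK.
  exact/eq_root_coefs/roots_of_length_mset_of_roots.
have S_sum : \sum_(s <- S) seg_length s == r.
  by rewrite -(is_blocks_of_mset _ S_le) SE.
have S_C : in_C r n S.
  (* An empty multiset would have total length 0, against [r_gt0]. *)
  rewrite /in_C S_sum S_le !andbT lt0n size_eq0; apply: contraTneq r_gt0 => S0.
  by rewrite -(eqP S_sum) S0 big_nil.
by exists (Sub S S_C); apply: val_inj.
Qed.

End SegmentBlocks.

Theorem theorem8p4 (R : realType) (r n : nat) (r_gt0 : 0 < r) (n_gt0 : 0 < n) :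
  exists f : C R r n -> Omega R r n, bijective f.
Proof.
exists (@Omega_of_blocks R r n \o @blocks_of_C R r n).
exact: bij_comp (Omega_of_blocks_bij R r n) (@blocks_of_C_bij R r n r_gt0).
Qed.
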